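(* Let $d$ denote either $d_1$ or $d_\infty$. For any $n\in\mathbb{N}$, $\delta\in(0,1)$ and $\varepsilon\in(0,1)$, let $\mathcal{A}$ be an algorithm that, given access to a $\mathrm{maxsample}$ oracle for any MNL $M$ supported on $[n]$, makes at most $m(n,\varepsilon,\delta)$ queries and then returns an MNL $\hat M$ such that $\Pr[d(M,\hat M)\le\varepsilon]\ge1-\delta$. Then the same algorithm $\mathcal{A}$, when given access to a $\mathrm{maxsample}$ oracle for a pseudo-MNL $\overline M$ supported on $[n]$, makes at most $m(n,\varepsilon,\delta)$ queries and returns an MNL $\hat M$ such that $\Pr[d(\overline M,\hat M)\le\varepsilon]\ge1-\delta$.
   Context: A subset distribution family on $[n]$ is a collection $H=\{\nu_S\}_{\emptyset\ne S\subseteq[n]}$ where each $\nu_S$ is a probability distribution on $S$; its $\mathrm{maxsample}$ oracle, given non-empty $S$, returns an independent sample from $\nu_S$. An MNL on $[n]$ with weights $w_1,\dots,w_n>0$ is identified with the family $\nu_S(i)=w_i/\sum_{j\in S}w_j$. For families $H,H'$: $d_1(H,H')=\max_S\|\nu_S-\nu'_S\|_1$ and $d_\infty(H,H')=\max_S\|\nu_S-\nu'_S\|_\infty$. A pseudo-MNL supported on $[n]$ is a limit point, with respect to $d$, of the set of MNLs on $[n]$ within the space of subset distribution families on $[n]$ (i.e. the limit of a sequence of MNLs on $[n]$). *)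

(* Defs.v *)
From HB Require Import structures.
From mathcomp Require Import all_boot all_order all_algebra.
From mathcomp Require Import all_classical all_reals all_analysis.
Import Order.TTheory GRing.Theory Num.Theory.
Import numFieldNormedType.Exports.

Set Implicit Arguments.
Unset Strict Implicit.
Unset Printing Implicit Defensive.

Local Open Scope classical_set_scope.
Local Open Scope ring_scope.

(* [n] is represented by 'I_n. *)
Definition nonempty_set (n : nat) := {S : {set 'I_n} | S != finset.set0}.

(* Each distribution nu_S on S is extended by 0 to the whole of [n]. *)
Record subset_family (R : realType) (n : nat) := SubsetFamily {
  nu :> nonempty_set n -> 'I_n -> R;
  nu_ge0 : forall S i, 0 <= nu S i;
  nu_out : forall (S : nonempty_set n) i, i \notin val S -> nu S i = 0;
  nu_sum : forall S : nonempty_set n, \sum_(i in val S) nu S i = 1 }.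

Record MNL (R : realType) (n : nat) := Mnl {
  weight : 'I_n -> R;
  weight_gt0 : forall i, 0 < weight i }.

Section MNLFamily.
Variables (R : realType) (n : nat) (M : MNL R n).

Definition mnl_nu (S : nonempty_set n) (i : 'I_n) : R :=
  if i \in val S then weight M i / \sum_(j in val S) weight M j else 0.

Lemma mnl_nu_ge0 S i : 0 <= mnl_nu S i.
Proof.
rewrite /mnl_nu; case: ifP => // _; apply: divr_ge0; first exact/ltW/weight_gt0.
by apply: sumr_ge0 => j _; exact/ltW/weight_gt0.
Qed.

Lemma mnl_nu_out (S : nonempty_set n) i : i \notin val S -> mnl_nu S i = 0.
Proof. by rewrite /mnl_nu => /negbTE ->. Qed.

Lemma mnl_nu_sum (S : nonempty_set n) : \sum_(i in val S) mnl_nu S i = 1.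
Proof.
under eq_bigr => i iS do rewrite /mnl_nu iS.
rewrite -mulr_suml divff//; apply: lt0r_neq0.
have /set0Pn[i iS] := valP S.
rewrite (bigD1 i) //=; apply: ltr_pwDl; first exact: weight_gt0.
by apply: sumr_ge0 => j _; exact/ltW/weight_gt0.
Qed.

Definition mnl_family : subset_family R n :=
  SubsetFamily mnl_nu_ge0 mnl_nu_out mnl_nu_sum.

End MNLFamily.

Coercion mnl_family : MNL >-> subset_family.

(* The maxima are over finite sets of nonnegative reals, so taking 0 as the
   value of the empty maximum matters only for n = 0. *)
Definition d_1 (R : realType) (n : nat) (H H' : subset_family R n) : R :=
  \big[Num.max/0]_(S : nonempty_set n) \sum_(i in val S) `|H S i - H' S i|.

Definition d_oo (R : realType) (n : nat) (H H' : subset_family R n) : R :=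
  \big[Num.max/0]_(S : nonempty_set n)
    \big[Num.max/0]_(i in val S) `|H S i - H' S i|.

Definition pseudo_MNL (R : realType) (n : nat)
    (d : subset_family R n -> subset_family R n -> R)
    (H : subset_family R n) : Prop :=
  exists M : nat -> MNL R n, (fun k => d (M k) H) @ \oo --> (0 : R).

Inductive action (R : realType) (n : nat) :=
  | Query of nonempty_set n
  | Return of MNL R n.
Arguments Query {R n} _.
Arguments Return {R n} _.

(* A randomized adaptive algorithm draws a seed once, and then chooses its next
   action from the seed and the oracle answers received so far, oldest first
   (the past queries are functions of these). Nothing forces it to halt.
   MNLs are identified with their families, so a returned MNL is only asked to
   be measurable through its choice probabilities. *)
Record algorithm (R : realType) (n : nat) := Algorithm {
  seed_display : measure_display;
  seed : measurableType seed_display;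
  seed_law : probability seed R;
  next :> seed -> seq 'I_n -> action R n;
  measurable_query : forall h S, measurable [set s | next s h = Query S];
  measurable_return : forall h (S : nonempty_set n) (i : 'I_n) (c : R),
    measurable [set s | exists2 M : MNL R n, next s h = Return M & M S i <= c] }.

Section Execution.
Variables (R : realType) (n : nat) (H : subset_family R n).

(* Whatever positive-probability answers the oracle gives, the strategy sigma
   halts after at most k queries counted from the history h. *)
Fixpoint halts_within (sigma : seq 'I_n -> action R n) (k : nat)
    (h : seq 'I_n) : Prop :=
  match sigma h with
  | Return _ => True
  | Query Q =>
      if k is k'.+1 then
        forall i, 0 < H Q i -> halts_within sigma k' (rcons h i)
      else False
  end.

(* Probability, over independent oracle answers, that the strategy sigma
   returns an element of B after at most k queries counted from h. *)
Fixpoint return_prob_within (sigma : seq 'I_n -> action R n) (B : set (MNL R n))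
    (k : nat) (h : seq 'I_n) : R :=
  match sigma h with
  | Return M => \1_B M
  | Query Q =>
      if k is k'.+1 then
        \sum_(i in val Q) H Q i * return_prob_within sigma B k' (rcons h i)
      else 0
  end.

Definition makes_at_most (A : algorithm R n) (m : nat) : Prop :=
  forall s : seed A, halts_within (A s) m [::].

(* Probability that A halts and returns an element of B. The probabilities of
   doing so within k queries increase with k, hence the supremum. *)
Definition return_prob (A : algorithm R n) (B : set (MNL R n)) : \bar R :=
  ereal_sup (range (fun k : nat =>
    (\int[seed_law A]_s (return_prob_within (A s) B k [::])%:E)%E)).

End Execution.

(* Main.v *)
(** Comparing the two oracles query by query, the probability of returning an
    MNL from a given set after at most m queries changes by at most m n eta when
    the choice probabilities change by at most eta. If MNLs M_k converge to
    Mbar, then the guarantee on M_k therefore gives, by the triangle inequality,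
    Pr[d(Mbar, Mhat) <= eps + eta] >= 1 - delta - m n eta for every eta > 0, and
    dominated convergence yields the limit eta -> 0. The query bound carries
    over because every answer that is possible for Mbar is possible for an MNL. *)
Require Import Defs.
From HB Require Import structures.
From mathcomp Require Import all_boot all_order all_algebra.
From mathcomp Require Import all_classical all_reals all_analysis.
From mathcomp Require Import measurable_realfun.
Import Order.TTheory GRing.Theory Num.Theory.
Import numFieldNormedType.Exports.

Set Implicit Arguments.
Unset Strict Implicit.
Unset Printing Implicit Defensive.

Local Open Scope classical_set_scope.
Local Open Scope ring_scope.

(** * Finite maxima and sums, and measurability through sublevel sets *)

Lemma measurable_bigmaxr d (T : measurableType d) (R : realType) (D : set T)
    (I : Type) (r : seq I) (P : pred I) (x0 : R) (F : I -> T -> R) :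
  (forall i, measurable_fun D (F i)) ->
  measurable_fun D (fun x => \big[Num.max/x0]_(i <- r | P i) F i x).
Proof.
move=> mF; elim: r => [|i r IH].
  by under eq_fun do rewrite big_nil; exact: measurable_cst.
under eq_fun do rewrite big_cons.
by case: (P i) => //; exact: measurable_maxr.
Qed.

Lemma measurable_sum_cond d (T : measurableType d) (R : realType) (D : set T)
    (I : Type) (r : seq I) (P : pred I) (F : I -> T -> R) :
  (forall i, P i -> measurable_fun D (F i)) ->
  measurable_fun D (fun x => \sum_(i <- r | P i) F i x).
Proof.
move=> mF; elim: r => [|i r IH].
  by under eq_fun do rewrite big_nil; exact: measurable_cst.
under eq_fun do rewrite big_cons.
by case: (boolP (P i)) => // Pi; apply: measurable_funD => //; exact: mF.
Qed.

Lemma measurable_sublevel d (T : measurableType d) (R : realType) (f : T -> R)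
    (c : R) : measurable_fun setT f -> measurable [set x | f x <= c].
Proof.
move=> mf; have := mf measurableT `]-oo, c]%classic (measurable_itv _).
by rewrite setTI; congr measurable; apply/seteqP; split => x /=;
  rewrite in_itv.
Qed.

Lemma sublevel_measurable_fun d (T : measurableType d) (R : realType)
    (f : T -> R) :
  (forall c, measurable [set x | f x <= c]) -> measurable_fun setT f.
Proof.
move=> mf; apply: (measurability (@RGenOInfty.G R)) => [|/= _ [_] [c ->] <-].
  exact: RGenOInfty.measurableE.
rewrite setTI (_ : _ @^-1` _ = ~` [set x | f x <= c]); first exact: measurableC.
by apply/seteqP; split => x /=; rewrite in_itv /= andbT ltNge => /negP.
Qed.

Lemma ler_bigmaxD (R : realDomainType) (I : finType) (P : pred I)
    (F G K : I -> R) :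
  (forall i, P i -> F i <= G i + K i) ->
  \big[Num.max/0]_(i | P i) F i <=
  \big[Num.max/0]_(i | P i) G i + \big[Num.max/0]_(i | P i) K i.
Proof.
move=> FGK; apply: bigmax_le => [|i Pi]; first by rewrite addr_ge0// bigmax_ge_id.
by apply: (le_trans (FGK i Pi)); rewrite lerD// le_bigmax_cond.
Qed.

(** * Properties shared by the two distances *)

Section Distances.
Variables (R : realType) (n : nat).
Variable d : subset_family R n -> subset_family R n -> R.
Hypothesis hd : d = @d_1 R n \/ d = @d_oo R n.
Implicit Types H K L : subset_family R n.

(** Turns closeness in either distance into the uniform bound on choice probabilities used to
    compare two oracles. *)
Lemma dist_coord H K S i : `|H S i - K S i| <= d H K.
Proof.
have [iS|iNS] := boolP (i \in val S); last first.
  rewrite !nu_out// subrr normr0.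
  by case: hd => ->; rewrite bigmax_ge_id.
case: hd => ->; apply: le_trans (le_bigmax _ _ S).
  by rewrite (bigD1 i)//= lerDl sumr_ge0.
exact: (le_bigmax_cond _ (fun i => `|H S i - K S i|)).
Qed.

Lemma distC H K : d H K = d K H.
Proof.
case: hd => ->; apply: eq_bigr => S _; apply: eq_bigr => i _; exact: distrC.
Qed.

Lemma dist_triangle H K L : d H L <= d H K + d K L.
Proof.
case: hd => ->; apply: ler_bigmaxD => S _.
  by rewrite -big_split ler_sum// => i _; exact: ler_distD.
by apply: ler_bigmaxD => i _; exact: ler_distD.
Qed.

Lemma measurable_dist disp (T : measurableType disp) H
    (F : T -> subset_family R n) :
  (forall S i, measurable_fun setT (fun t => F t S i)) ->
  measurable_fun setT (fun t => d H (F t)).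
Proof.
move=> mF.
have mabs S i : measurable_fun setT (fun t => `|H S i - F t S i|).
  apply: measurableT_comp => //.
  by apply: measurable_funB => //; exact: measurable_cst.
case: hd => ->; apply: measurable_bigmaxr => S.
  exact: measurable_sum_cond.
exact: measurable_bigmaxr.
Qed.

End Distances.

(** * Dependence of an execution on the oracle and on the target set *)

Section Executions.
Variables (R : realType) (n : nat).
Implicit Types (H K : subset_family R n) (sigma : seq 'I_n -> action R n).

(** The tree of answers possible under [K] is a subtree of the one for [H]. *)
Lemma halts_within_abs_continuous H K sigma k h :
  (forall S i, 0 < K S i -> 0 < H S i) ->
  halts_within H sigma k h -> halts_within K sigma k h.
Proof.
move=> KH; elim: k h => [|k IH] h /=; case: (sigma h) => // Q hQ i Ki.
by apply: IH; apply: hQ; exact: KH.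
Qed.

Lemma mnl_nu_gt0 (M : MNL R n) (S : nonempty_set n) i :
  i \in val S -> 0 < M S i.
Proof.
move=> iS; rewrite /= /mnl_nu iS divr_gt0 ?weight_gt0//.
rewrite (bigD1 i)//= ltr_pwDl ?weight_gt0// sumr_ge0// => j _.
exact/ltW/weight_gt0.
Qed.

Lemma return_prob_within_ge0 H sigma B k h :
  0 <= return_prob_within H sigma B k h.
Proof.
elim: k h => [|k IH] h /=; case: (sigma h) => // Q.
by apply: sumr_ge0 => i _; rewrite mulr_ge0// nu_ge0.
Qed.

Lemma return_prob_within_le1 H sigma B k h :
  return_prob_within H sigma B k h <= 1.
Proof.
have indic_le1 M : (\1_B M : R) <= 1 by rewrite indicE; case: (_ \in _).
elim: k h => [|k IH] h /=; case: (sigma h) => // Q.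
by rewrite -(nu_sum H Q) ler_sum// => i _; rewrite ler_piMr// nu_ge0.
Qed.

(** Once halting within [m] queries is certain, a larger budget [k] adds nothing and a smaller one
    can only lose executions. *)
Lemma return_prob_within_halts H sigma B k m h : halts_within H sigma m h ->
  return_prob_within H sigma B k h <= return_prob_within H sigma B m h.
Proof.
elim: m k h => [|m IH] [|k] h /=; case: (sigma h) => // Q hQ.
  by rewrite sumr_ge0// => i _; rewrite mulr_ge0 ?nu_ge0 ?return_prob_within_ge0.
(* An answer of probability 0 need not lead to a halt, but its term vanishes on both sides. *)
apply: ler_sum => i _; have := nu_ge0 H Q i; rewrite le_eqVlt => /predU1P[<-|Hi].
  by rewrite !mul0r.
by rewrite ler_pM2l//; apply: IH; exact: hQ.
Qed.

(** Replacing the oracle costs at most [n * eta] per query, and these errors add up along the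
    induction on the budget. *)
Lemma return_prob_within_perturb H K sigma B B' eta k h : B `<=` B' ->
  (forall S i, `|H S i - K S i| <= eta) ->
  return_prob_within H sigma B k h <=
  return_prob_within K sigma B' k h + (k * n)%:R * eta.
Proof.
move=> BB' HK.
have indicB M : (\1_B M : R) <= \1_B' M.
  rewrite !indicE; have [/set_mem/BB'/mem_set->//|] := boolP (M \in B).
  by rewrite ler0n.
elim: k h => [|k IH] h /=; case: (sigma h) => [Q|M].
- by rewrite mul0n mul0r addr0.
- by rewrite mul0n mul0r addr0.
- set pH := fun i => return_prob_within H sigma B k (rcons h i).
  set pK := fun i => return_prob_within K sigma B' k (rcons h i).
  have eta0 i : 0 <= eta := le_trans (normr_ge0 _) (HK Q i).
  (* The difference splits as [(H Q i - K Q i) * pH i + K Q i * (pH i - pK i)]: the first term is at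
     most [eta] since [pH i] lies in [0, 1], the second is bounded by induction. *)
  have step i : H Q i * pH i <= K Q i * pK i + (eta + K Q i * ((k * n)%:R * eta)).
    rewrite addrCA -mulrDr -[leLHS](subrK (K Q i * pH i)) -mulrBl lerD//.
      have [pH0 pH1] : 0 <= pH i /\ pH i <= 1.
        by rewrite return_prob_within_ge0 return_prob_within_le1.
      apply: (@le_trans _ _ (eta * pH i)); last by rewrite ler_piMr// (eta0 i).
      by rewrite ler_wpM2r// (le_trans (ler_norm _)).
    by rewrite ler_wpM2l ?nu_ge0// IH.
  apply: (le_trans (ler_sum _ (fun i _ => step i))).
  (* The weights [K Q i] sum to 1, so the inductive error is kept as it is; the new error is
     [#|val Q|] times [eta]. *)
  rewrite big_split lerD2l /= big_split /= -mulr_suml nu_sum mul1r.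
  rewrite mulSn natrD mulrDl lerD2r.
  case: (set_0Vmem (val Q)) => [Q0|[i iQ]]; first by have := valP Q; rewrite Q0 eqxx.
  rewrite sumr_const -[eta *+ _]mulr_natl ler_wpM2r ?(eta0 i)// ler_nat.
  by rewrite -[leqRHS]card_ord max_card.
- rewrite (le_trans (indicB M))// lerDl.
  (* For [n = 0] the bound on [eta] is vacuous and [eta] may be negative, but the factor [n] kills
     the error term. *)
  case: (posnP n) => [n0|n0]; first by rewrite n0 muln0 mul0r.
  have Q : nonempty_set n.
    by exists [set Ordinal n0]%SET; apply/set0Pn; exists (Ordinal n0); rewrite inE.
  by rewrite mulr_ge0// (le_trans (normr_ge0 _) (HK Q (Ordinal n0))).
Qed.

(** For fixed [sigma] and [k] this is a finite combination of indicator values with fixed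
    coefficients. *)
Lemma cvg_return_prob_within H sigma (B_ : nat -> set (MNL R n)) B k h :
  (forall M, (\1_(B_ j) M : R) @[j --> \oo] --> (\1_B M : R)) ->
  return_prob_within H sigma (B_ j) k h @[j --> \oo] -->
  return_prob_within H sigma B k h.
Proof.
move=> cB; elim: k h => [|k IH] h /=; case: (sigma h) => // Q; first exact: cvg_cst.
apply: cvg_big => [|i _]; first exact: add_continuous.
by apply: cvgMl_tmp; exact: IH.
Qed.

(** The indicators are eventually constant: if [f M] exceeds [eps], then [eta j] is eventually
    smaller than the gap. *)
Lemma cvg_indic_sublevel (f : MNL R n -> R) (eps : R) (eta : nat -> R) M :
  (forall j, 0 <= eta j) -> eta @ \oo --> 0 ->
  (\1_[set N | f N <= eps + eta j] M : R) @[j --> \oo] -->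
  (\1_[set N | f N <= eps] M : R).
Proof.
move=> eta0 ceta; apply: cvg_near_cst.
have [fle|flt] := leP (f M) eps.
  apply: nearW => j; rewrite !indicE !mem_set//=.
  by rewrite (le_trans fle)// lerDl.
have : 0 < f M - eps by rewrite subr_gt0.
move=> /(cvgr_lt _ ceta); apply: filterS => j etaj.
by rewrite !indicE !memNset//=; apply/negP; rewrite -ltNge// -ltrBrDl.
Qed.

End Executions.

(** * Measurability in the seed *)

Section Measurability.
Variables (R : realType) (n : nat) (A : algorithm R n).

Lemma measurable_queries h : measurable [set s | exists S, A s h = Query S].
Proof.
rewrite (_ : [set _ | _] = \bigcup_S [set s | A s h = Query S]).
  by apply: fin_bigcup_measurable => [|S _];
    [exact: finite_finset|exact: measurable_query].
by apply/seteqP; split => s [S]; [exists S|move=> _; exists S].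
Qed.

Lemma measurable_return_dist d (hd : d = @d_1 R n \/ d = @d_oo R n)
    (H : subset_family R n) (c : R) h :
  measurable [set s | exists2 M : MNL R n, A s h = Return M & d H M <= c].
Proof.
(* On seeds that make a query, [H] is a dummy value; these seeds are removed at the end. *)
pose F s : subset_family R n := if A s h is Return M then mnl_family M else H.
have mF S i : measurable_fun setT (fun s => F s S i).
  apply: sublevel_measurable_fun => b.
  rewrite (_ : [set _ | _] =
    [set s | exists2 M : MNL R n, A s h = Return M & M S i <= b] `|`
    (if H S i <= b then [set s | exists Q, A s h = Query Q] else set0)).
    apply: measurableU; first exact: measurable_return.
    by case: ifP => // _; exact: measurable_queries.
  apply/seteqP; split => s /=; rewrite /F.
    case E: (A s h) => [Q|M] Mb; [right|left; by exists M].
    by rewrite Mb; exists Q.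
  by move=> [[M -> //]|]; case: ifP => // Hb [Q ->].
rewrite (_ : [set _ | _] =
    [set s | d H (F s) <= c] `\` [set s | exists Q, A s h = Query Q]).
  apply: measurableD; last exact: measurable_queries.
  by apply: measurable_sublevel; exact: measurable_dist.
apply/seteqP; split => s /=; rewrite /F.
  by move=> [M -> Mc]; split => // -[].
by case E: (A s h) => [Q|M] [Mc nQ]; [case: nQ; exists Q|exists M].
Qed.

Lemma measurable_return_prob_within (H : subset_family R n)
    (B : set (MNL R n)) k h :
  (forall h, measurable [set s | exists2 M : MNL R n, A s h = Return M & B M]) ->
  measurable_fun setT (fun s => return_prob_within H (A s) B k h).
Proof.
move=> mB; pose ret h := [set s | exists2 M : MNL R n, A s h = Return M & B M].
have indic_ret h' s :
    \1_(ret h') s = (if A s h' is Return M then \1_B M else 0) :> R.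
  rewrite !indicE; case E: (A s h') => [Q|M].
    by rewrite memNset// /ret /= E => -[].
  rewrite indicE; congr ((nat_of_bool _)%:R); apply/idP/idP => /set_mem.
    by rewrite /ret /= E => -[_ [<-] BM]; exact/mem_set.
  by move=> BM; apply/mem_set; exists M.
elim: k h => [|k IH] h.
  rewrite (_ : (fun _ => _) = \1_(ret h)).
    by apply: measurable_indic; exact: mB.
  by apply/funext => s; rewrite indic_ret.
pose answer (Q : nonempty_set n) s :=
  \sum_(i in val Q) H Q i * return_prob_within H (A s) B k (rcons h i).
(* The next query depends on the seed, so the function is cut along the finitely many events
   [A s h = Query Q]. *)
rewrite (_ : (fun _ => _) = (fun s => \1_(ret h) s +
    \sum_(Q : nonempty_set n) \1_[set s | A s h = Query Q] s * answer Q s)).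
  apply: measurable_funD; first by apply: measurable_indic; exact: mB.
  apply: measurable_sum_cond => Q _; apply: measurable_funM.
    by apply: measurable_indic; exact: measurable_query.
  by apply: measurable_sum_cond => i _; apply: measurable_funM.
apply/funext => s /=; rewrite indic_ret; case E: (A s h) => [Q|M].
  rewrite add0r (bigD1 Q)//= [in RHS]big1 => [|Q' Q'Q].
    by rewrite indicE mem_set// mul1r addr0.
  by rewrite indicE memNset ?mul0r//= E => -[QQ']; rewrite QQ' eqxx in Q'Q.
by rewrite big1 ?addr0// => Q _; rewrite indicE memNset ?mul0r//= E.
Qed.

End Measurability.

(** * Transfer of the guarantee from MNLs to their limits *)

Theorem theoremD2 (R : realType) (n : nat) (delta eps : R)
    (d : subset_family R n -> subset_family R n -> R)
    (m : nat -> R -> R -> nat) (A : algorithm R n)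
    (hd : d = @d_1 R n \/ d = @d_oo R n)
    (hdelta : 0 < delta < 1) (heps : 0 < eps < 1)
    (hA : forall M : MNL R n,
        makes_at_most M A (m n eps delta) /\
        ((1 - delta)%:E <=
           return_prob M A [set Mhat : MNL R n | (d M Mhat <= eps)%R])%E) :
  forall Mbar : subset_family R n, pseudo_MNL d Mbar ->
    makes_at_most Mbar A (m n eps delta) /\
    ((1 - delta)%:E <=
       return_prob Mbar A [set Mhat : MNL R n | (d Mbar Mhat <= eps)%R])%E.
Proof.
move=> Mbar [M_ cM]; set k := m n eps delta; split.
  (* Any MNL serves here: it gives positive probability to every element of [S], and [Mbar] vanishes
     outside [S]. *)
  move=> s; apply: (@halts_within_abs_continuous _ _ (M_ 0)) => [S i Mi|].
    by apply: mnl_nu_gt0; apply: contraTT Mi => iS; rewrite nu_out ?ltxx.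
  exact: (hA _).1.
pose eta j : R := j.+1%:R^-1.
have eta_gt0 j : 0 < eta j by rewrite invr_gt0 ltr0n.
have ceta : eta @ \oo --> 0 := cvg_harmonic.
pose B_ j := [set Mhat : MNL R n | d Mbar Mhat <= eps + eta j].
pose p B s := return_prob_within Mbar (A s) B k [::].
have mp c : measurable_fun setT
    (EFin \o p [set Mhat : MNL R n | d Mbar Mhat <= c]).
  apply/measurable_EFinP; apply: measurable_return_prob_within => h.
  exact: measurable_return_dist.
apply: (@le_trans _ _ (\int[seed_law A]_s
    (p [set Mhat : MNL R n | (d Mbar Mhat <= eps)%R] s)%:E)%E); last first.
  by apply: ereal_sup_ubound; exists k.
have approx j : ((1 - delta)%:E <=
    \int[seed_law A]_s (p (B_ j) s)%:E + ((k * n)%:R * eta j)%:E)%E.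
  have [i di] : exists i, d (M_ i) Mbar <= eta j.
    have [i _ di] := cvgr_le _ cM _ (eta_gt0 j).
    by exists i; exact: (di i (leqnn i)).
  (* The guarantee for [M_ i] is a supremum over all budgets [l]; each is bounded separately, the
     query bound replacing [l] by [k]. *)
  apply: (le_trans (hA (M_ i)).2); apply: ge_ereal_sup => _ [l _ <-].
  (* The seed law has mass 1, so the error is the integral of a constant and the comparison can be
     made seed by seed. *)
  have -> : (((k * n)%:R * eta j)%:E =
      \int[seed_law A]_s (cst ((k * n)%:R * eta j)%:E s))%E.
    by rewrite integral_cst// [X in (_ * X)%E]probability_setT mule1.
  have C0 : 0 <= (k * n)%:R * eta j by rewrite mulr_ge0// ltW.
  rewrite -ge0_integralD//; last 2 first.
    by move=> s _; rewrite lee_fin return_prob_within_ge0.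
    exact: mp.
  apply: ge0_le_integral => //.
  - by move=> s _; rewrite lee_fin return_prob_within_ge0.
  - apply/measurable_EFinP; apply: measurable_return_prob_within => h.
    exact: measurable_return_dist.
  - by apply: emeasurable_funD => //; exact: mp.
  move=> s _; rewrite -EFinD lee_fin.
  apply: (le_trans (return_prob_within_halts _ _ ((hA (M_ i)).1 s))).
  apply: return_prob_within_perturb => [N /= dN|S x].
    apply: (le_trans (dist_triangle hd _ (M_ i) _)).
    by rewrite addrC lerD// distC.
  exact: le_trans (dist_coord hd _ _ _ _) di.
(* Dominated convergence with the constant bound 1, pointwise in the seed because the sets [B_ j]
   shrink to the closed condition [d Mbar Mhat <= eps]. *)
have cint : (\int[seed_law A]_s (p (B_ j) s)%:E @[j --> \oo] -->
    \int[seed_law A]_s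
      (p [set Mhat : MNL R n | (d Mbar Mhat <= eps)%R] s)%:E)%E.
  have [] // := @dominated_convergence _ _ _ (seed_law A) _ measurableT
    (fun j => EFin \o p (B_ j))
    (EFin \o p [set Mhat : MNL R n | d Mbar Mhat <= eps]) (cst 1%E).
  - by move=> j; exact: mp.
  - apply/aeW => s _; apply: cvg_EFin; first exact: nearW.
    apply: cvg_return_prob_within => N.
    by apply: cvg_indic_sublevel => // j; exact: ltW.
  - exact: finite_measure_integrable_cst.
  - apply/aeW => s j _; rewrite /= lee_fin ger0_norm ?return_prob_within_ge0//.
    exact: return_prob_within_le1.
have cC : ((k * n)%:R * eta j)%:E @[j --> \oo] --> 0%E.
  apply: cvg_EFin; first exact: nearW.
  by rewrite -[X in _ --> X](mulr0 (k * n)%:R); exact: cvgMl_tmp.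
rewrite -[leRHS]adde0.
apply: cvge_to_ge (cvgeD (fin_num_adde_defl _ _) cint cC) _ => //.
exact: nearW.
Qed.
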